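(* Let $G$ be a bipartite graph of order $n$ with minimum degree $\delta(G)\geq 2$. Then $$\gamma_{t}^{oi}(G)=\gamma_{d}^{oi}(G)\leq\frac{n+\gamma_{t}(G)}{2}.$$ Furthermore, this bound is sharp, i.e. there are graphs satisfying the hypotheses for which equality holds.
   Context: All graphs are finite and simple. $N[v]$ denotes the closed neighborhood of $v$. For a graph $G$ without isolated vertices: a total dominating set is a set $S\subseteq V(G)$ such that every vertex of $V(G)$ has at least one neighbor in $S$, and the total domination number $\gamma_t(G)$ is the smallest cardinality of such a set; a total outer-independent dominating (TOID) set is a total dominating set $S$ with $V(G)\setminus S$ independent, and $\gamma_{t}^{oi}(G)$ is the smallest cardinality of a TOID set; a double outer-independent dominating (DOID) set is a set $D\subseteq V(G)$ such that $|N[v]\cap D|\geq2$ for all $v\in V(G)$ and $V(G)\setminus D$ is independent, and $\gamma_{d}^{oi}(G)$ is the smallest cardinality of a DOID set. *)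

(* Defs.v *)
From mathcomp Require Import all_boot.

Set Implicit Arguments.
Unset Strict Implicit.
Unset Printing Implicit Defensive.

Record sgraph : Type := SGraph {
  vertex :> finType;
  edge : rel vertex;
  edge_sym : symmetric edge;
  edge_irrefl : irreflexive edge
}.

Definition open_neigh (G : sgraph) (v : G) : {set G} := [set u | edge v u].

Definition closed_neigh (G : sgraph) (v : G) : {set G} := v |: open_neigh v.

Definition degree (G : sgraph) (v : G) : nat := #|open_neigh v|.

(* Every degree is below #|G|, so the neutral element #|G| only matters when
   G has no vertices; then [min_degree G = 0]. *)
Definition min_degree (G : sgraph) : nat := \big[minn/#|G|]_(v : G) degree v.

Definition independent (G : sgraph) (S : {set G}) : bool :=
  [forall u in S, forall v in S, ~~ edge u v].

Definition bipartite (G : sgraph) : Prop :=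
  exists A : {set G}, independent A /\ independent (~: A).

Definition total_dominating (G : sgraph) (S : {set G}) : bool :=
  [forall v : G, exists u in S, edge v u].

Definition toid (G : sgraph) (S : {set G}) : bool :=
  total_dominating S && independent (~: S).

Definition doid (G : sgraph) (D : {set G}) : bool :=
  [forall v : G, 2 <= #|closed_neigh v :&: D|] && independent (~: D).

(* The three numbers below are meaningful for graphs without isolated vertices:
   the full vertex set then satisfies each property, so that [arg min] does
   select a set of minimum size among those with the property. *)
Definition gamma_t (G : sgraph) : nat :=
  #|[arg min_(S < [set: G] | total_dominating S) #|S|]|.

Definition gamma_t_oi (G : sgraph) : nat :=
  #|[arg min_(S < [set: G] | toid S) #|S|]|.

Definition gamma_d_oi (G : sgraph) : nat :=
  #|[arg min_(D < [set: G] | doid D) #|D|]|.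

(* Main.v *)
Require Import Defs.
From mathcomp Require Import all_boot all_order all_algebra.
Import Order.TTheory GRing.Theory Num.Theory.
Local Open Scope ring_scope.

Set Implicit Arguments.
Unset Strict Implicit.
Unset Printing Implicit Defensive.

(** When every degree is at least two, the TOID sets and the DOID sets are the
    same sets ([toid_doid]).  If [S] is TOID, the closed neighbourhood of a
    vertex of [S] meets [S] in the vertex itself and in a neighbour, while a
    vertex outside [S] has all of its neighbours, hence two of them, in [S],
    because the complement is independent.  Conversely, of two elements of [S]
    in a closed neighbourhood, one is not the centre.  So the two numbers
    coincide.

    For the upper bound, let [S] be a minimum total dominating set and let [A]
    be one side of the bipartition.  Adding either side to [S] gives a TOID set,
    and the two TOID sets [S :|: A] and [S :|: ~: A] cover [G] and meet in [S],
    so their sizes add up to [#|G| + #|S|]; the smaller one satisfies the bound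
    ([gamma_t_oi_bound]).

    The 4-cycle attains it: two adjacent vertices dominate it totally, whereas
    a TOID set can miss at most one vertex, so that 3 = (4 + 2) / 2. *)

Lemma min_degree_le (G : sgraph) (v : G) : (min_degree G <= degree v)%N.
Proof.
rewrite /min_degree; elim: (index_enum G) (mem_index_enum v) => // u r IHr.
rewrite big_cons inE geq_min => /orP[/eqP-> | /IHr->]; last by rewrite orbT.
by rewrite leqnn.
Qed.

Lemma min_degree_ge (G : sgraph) (k : nat) :
  (k <= #|G|)%N -> (forall v : G, (k <= degree v)%N) -> (k <= min_degree G)%N.
Proof.
move=> kG kdeg; apply: (big_ind (fun m => k <= m)%N) => // x y kx ky.
by rewrite leq_min kx ky.
Qed.

Lemma total_dominatingP (G : sgraph) (S : {set G}) :
  reflect (forall v : G, exists2 u, u \in S & edge v u) (total_dominating S).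
Proof. exact: 'forall_exists_inP. Qed.

Lemma independentP (G : sgraph) (S : {set G}) :
  reflect {in S &, forall u v : G, ~~ edge u v} (independent S).
Proof.
apply: (iffP forall_inP) => [H u v uS vS | H u uS].
  exact: (forall_inP (H u uS)).
by apply/forall_inP => v vS; apply: H.
Qed.

Lemma independentS (G : sgraph) (S T : {set G}) :
  S \subset T -> independent T -> independent S.
Proof.
move=> /subsetP ST /independentP T0; apply/independentP => u v uS vS.
by apply: T0; apply: ST.
Qed.

Lemma total_dominatingS (G : sgraph) (S T : {set G}) :
  S \subset T -> total_dominating S -> total_dominating T.
Proof.
move=> /subsetP ST /total_dominatingP dS; apply/total_dominatingP => v.
by have [u /ST] := dS v; exists u.
Qed.

Lemma total_dominatingT (G : sgraph) :
  (0 < min_degree G)%N -> total_dominating [set: G].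
Proof.
move=> deg; apply/total_dominatingP => v.
have /card_gt0P[u] := leq_trans deg (min_degree_le v).
by rewrite inE => vu; exists u.
Qed.

Lemma toidT (G : sgraph) : (0 < min_degree G)%N -> toid [set: G].
Proof.
move=> /total_dominatingT dT; rewrite /toid dT.
by apply/independentP => u v; rewrite setCT inE.
Qed.

Lemma toid_doid (G : sgraph) (S : {set G}) :
  (1 < min_degree G)%N -> toid S = doid S.
Proof.
move=> deg; rewrite /toid /doid; case: independentP => [ind|]; last by rewrite !andbF.
rewrite !andbT; apply/total_dominatingP/forallP => dS v.
- have [vS | vS] := boolP (v \in S).
  + have [u uS vu] := dS v.
    have uv : u != v by apply: contraTneq vu => ->; rewrite edge_irrefl.
    rewrite -[X in (X <= _)%N](_ : #|[set u; v]| = 2)%N; last by rewrite cards2 uv.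
    apply/subset_leq_card/subsetP => w.
    by rewrite !inE => /orP[]/eqP->; rewrite ?uS ?vS ?vu ?eqxx ?orbT.
  + apply: leq_trans deg (leq_trans (min_degree_le v) _).
    apply/subset_leq_card/subsetP => w; rewrite !inE => vw; rewrite vw orbT /=.
    by apply: contraLR vw => wS; apply: ind; rewrite inE.
- (* Two elements of [N[v] :&: S]: one of them is not [v]. *)
  have /card_gt1P[x [y [xS yS xy]]] := dS v.
  have [u uvS uv] : exists2 u, u \in closed_neigh v :&: S & u != v.
    by have [xv|] := eqVneq x v; [exists y; rewrite // -xv eq_sym | exists x].
  by move: uvS; rewrite !inE (negPf uv) /= => /andP[vu uS]; exists u.
Qed.

Lemma gamma_t_le (G : sgraph) (S : {set G}) :
  total_dominating S -> (gamma_t G <= #|S|)%N.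
Proof.
move=> dS; rewrite /gamma_t; case: arg_minnP => [|T _]; last exact.
exact: total_dominatingS (subsetT S) dS.
Qed.

Lemma gamma_t_witness (G : sgraph) :
  (0 < min_degree G)%N -> exists2 S : {set G}, total_dominating S & #|S| = gamma_t G.
Proof.
move=> deg; rewrite /gamma_t.
by case: arg_minnP => [|S dS _]; [exact: total_dominatingT | exists S].
Qed.

Lemma gamma_t_oi_le (G : sgraph) (S : {set G}) :
  (0 < min_degree G)%N -> toid S -> (gamma_t_oi G <= #|S|)%N.
Proof.
move=> deg dS; rewrite /gamma_t_oi; case: arg_minnP => [|T _]; last exact.
exact: toidT.
Qed.

Lemma gamma_t_oi_witness (G : sgraph) :
  (0 < min_degree G)%N -> exists2 S : {set G}, toid S & #|S| = gamma_t_oi G.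
Proof.
move=> deg; rewrite /gamma_t_oi.
by case: arg_minnP => [|S dS _]; [exact: toidT | exists S].
Qed.

Lemma gamma_t_oi_d_oi (G : sgraph) :
  (1 < min_degree G)%N -> gamma_t_oi G = gamma_d_oi G.
Proof.
move=> deg; have allT := toidT (ltnW deg).
rewrite /gamma_t_oi /gamma_d_oi.
case: arg_minnP => // S; rewrite toid_doid // => dS minS.
case: arg_minnP => [|D dD minD]; first by rewrite -toid_doid.
by apply/eqP; rewrite eqn_leq minD // minS // toid_doid.
Qed.

Lemma gamma_t_oi_bound (G : sgraph) :
  bipartite G -> (0 < min_degree G)%N ->
  (2 * gamma_t_oi G <= #|G| + gamma_t G)%N.
Proof.
move=> [A [indA indCA]] deg; have [S dS <-] := gamma_t_witness deg.
have leU (B : {set G}) : independent (~: B) -> (gamma_t_oi G <= #|S :|: B|)%N.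
  move=> indB; apply: gamma_t_oi_le => //; apply/andP; split.
    exact: total_dominatingS (subsetUl S B) dS.
  by apply: independentS indB; rewrite setCS subsetUr.
rewrite mul2n -addnn (leq_trans (leq_add (leU A indCA) (leU (~: A) _))) ?setCK //.
by rewrite -cardsUI -setUUr -setUIr setUCr setICr setUT setU0 cardsT.
Qed.

(** The 4-cycle, seen as the complete bipartite graph on two sides of two
    vertices: the first coordinate of a vertex tells its side. *)
Definition C4_edge : rel (bool * bool) := fun u v => u.1 != v.1.

Lemma C4_edge_sym : symmetric C4_edge.
Proof. by move=> u v; rewrite /C4_edge eq_sym. Qed.

Lemma C4_edge_irrefl : irreflexive C4_edge.
Proof. by move=> u; rewrite /C4_edge eqxx. Qed.

Definition C4 : sgraph := SGraph C4_edge_sym C4_edge_irrefl.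

Lemma card_C4 : #|C4| = 4%N.
Proof. by rewrite card_prod card_bool. Qed.

Lemma C4_bipartite : bipartite C4.
Proof.
exists [set u : C4 | u.1].
by split; apply/independentP => -[[] i] [[] j]; rewrite !inE.
Qed.

Lemma C4_min_degree : (2 <= min_degree C4)%N.
Proof.
apply: min_degree_ge => [|v]; first by rewrite card_C4.
apply/card_gt1P; exists (~~ v.1, true), (~~ v.1, false).
by split; rewrite ?inE //=; case: v => -[].
Qed.

Lemma gamma_t_C4 : (gamma_t C4 <= 2)%N.
Proof.
pose S : {set C4} := [set (true, true); (false, true)].
have <- : #|S| = 2%N by rewrite cards2.
apply/gamma_t_le/total_dominatingP => v.
by exists (~~ v.1, true); case: v => -[] i; rewrite ?inE.
Qed.

(** Two vertices missed by a TOID set are on the same side, by independence; if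
    they were distinct they would fill this side, and the vertices of the other
    side would not be dominated. *)
Lemma gamma_t_oi_C4 : (3 <= gamma_t_oi C4)%N.
Proof.
have [S /andP[/total_dominatingP dS /independentP ind] <-] :=
  gamma_t_oi_witness (ltnW C4_min_degree).
suff le1 : (#|~: S| <= 1)%N.
  rewrite -(leq_add2r 1) addn1 -[X in (X <= _)%N]card_C4.
  by rewrite -(cardsC S) leq_add2l.
apply/card_le1_eqP => u v uS vS; apply/eqP/contraT => uv.
have /eqP side : u.1 == v.1 by have := ind u v uS vS; rewrite negbK.
have [w wS uw] := dS (~~ u.1, true).
have : (w == u) || (w == v).
  by move: u v w side uv uw {uS vS wS} => [[] []] [[] []] [[] []].
by case/orP => /eqP wE; move: wS uS vS; rewrite wE !inE => ->.
Qed.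

Theorem theorem4p10 :
  (forall (G : sgraph) (n : nat),
      #|G| = n -> bipartite G -> (2 <= min_degree G)%N ->
      gamma_t_oi G = gamma_d_oi G /\
      ((gamma_d_oi G)%:R : rat) <= (n%:R + (gamma_t G)%:R) / 2)
  /\
  (exists G : sgraph,
      [/\ bipartite G, (2 <= min_degree G)%N &
          ((gamma_t_oi G)%:R : rat) = (#|G|%:R + (gamma_t G)%:R) / 2]).
Proof.
split=> [G n <- bipG deg | ].
  split; first exact: gamma_t_oi_d_oi.
  rewrite -gamma_t_oi_d_oi // ler_pdivlMr // mulrC -natrM -natrD ler_nat.
  exact: gamma_t_oi_bound (ltnW deg).
exists C4; split; [exact: C4_bipartite | exact: C4_min_degree |].
have twice : (2 * gamma_t_oi C4 = #|C4| + gamma_t C4)%N.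
  apply/anti_leq/andP; split.
    exact: gamma_t_oi_bound C4_bipartite (ltnW C4_min_degree).
  rewrite card_C4; apply: (@leq_trans (2 * 3)%N).
    by rewrite (leq_add2l 4 _ 2) gamma_t_C4.
  by rewrite leq_pmul2l ?gamma_t_oi_C4.
by rewrite -natrD -twice natrM mulrC mulKf.
Qed.
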